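(* (i) Each of the classical OLAP operations $\mathsf{DICE}$, $\mathsf{SLICE}$, $\mathsf{SLICE\text{-}DICE}$, $\mathsf{ROLL\text{-}UP}$ and $\mathsf{DRILL\text{-}DOWN}$ on data cubes is expressible as an OLAP operation, that is, as a finite sequence of atomic OLAP transformations followed by the creation of an output flag (possibly preceded by a destructor). (ii) Every finite composition of classical OLAP operations is expressible by OLAP operations: for every finite sequence $C_1,\dots,C_r$ of classical OLAP operations, each taking as input the output of the previous one, there is a finite sequence of OLAP operations whose successive application to the input data cube yields the output of $C_r\circ\cdots\circ C_1$ on that cube.
   Context: **Dimensions.** A dimension $D$ has a schema $\sigma(D)$: a finite lattice, viewed as a directed graph of levels, with a unique top node $All$ (only incoming edges) and a unique bottom node $Bottom$ (only outgoing edges), all maximal-length paths going from $Bottom$ to $All$. A path from $Bottom$ to $All$ is a hierarchy of $\sigma(D)$. Each level $\ell$ has a non-empty finite set $dom(D.\ell)$, with $dom(D.All)=\{all\}$ and $dom(D.Bottom)=dom(D)$, and $dom(D)$ is totally ordered by $<$. A dimension graph $I(\sigma(D))$ is a directed acyclic graph with node set $\bigcup_\ell dom(D.\ell)$, in which an edge from $a\in dom(D.\ell)$ to $a'\in dom(D.\ell')$ can exist only if $\ell\to\ell'$ is an edge of $\sigma(D)$. For each hierarchy $H$, the subgraph $I_H(\sigma(D))$ on the nodes belonging to the levels of $H$ is a directed tree, directed towards its root $all$. Write $\rho_H(a,b)$ (''$a$ rolls up to $b$'') if $b$ is reachable from $a$ in $I_H(\sigma(D))$ (with $a$ rolling up to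 itself), and $\rho$ if $H$ is clear from the context. Dimension graphs are sound: for every level $\ell$, hierarchies $H_1,H_2$ reaching $\ell$ from $Bottom$, $a\in dom(D)$ and $b_1,b_2\in dom(D.\ell)$, $\rho_{H_1}(a,b_1)$ and $\rho_{H_2}(a,b_2)$ imply $b_1=b_2$. Every $b\in dom(D.\ell)$ has at least one $a\in dom(D)$ with $\rho(a,b)$; $rep(b)$ denotes the smallest such $a$. Put $b_1<b_2$ in $dom(D.\ell)$ iff $rep(b_1)<rep(b_2)$. **Data cubes.** A $d$-dimensional data cube $\mathcal D$ ($d\ge1$) consists of: the matrix $M(\mathcal D)=dom(D_1)\times\cdots\times dom(D_d)$, whose elements are called cells; sound dimension graphs $I(\sigma(D_i))$; protected measures $\mu_1,\dots,\mu_k$ and computed measures $\tau_1,\dots,\tau_l$ ($l\ge0$), which are functions from the cells to $\mathbb Q$; and a flag $\varphi$ from the cells to $\{0,1\}$. Some cells may be empty (destroyed): they carry no measures and no flag, they are ignored in all computations, and no measure is ever added to them. **Prime labels.** These are the numbers $1,\sqrt2,\sqrt3,\sqrt5,\sqrt7,\dots,\sqrt{p_n},\dots$ ($p_n$ the $n$-th prime), used symbolically; intermediate computed measures may have values involving them. A prime product label is a product of prime labels coming from labelings of different dimensions that use disjoint sets of labels. If the label of a cell is the product of labels for the dimensions with index in $I\subseteq\{1,\dots,d\}$, then for a rational-valued measure $\mu$ the sum over all non-empty cells of $\mu$ times the label is called a (full or partial) prime sum; it can be written $\sum_w a_w w$, with $w$ ranging over the labels that occur. **Atomic OLAP transformations.**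 Each creates, in all non-empty cells $(x_1,\dots,x_d)$, a new measure $\tau_{new}$ from the existing measures; $\alpha,\beta$ denote existing (protected or computed) measures. - Arithmetic: $\tau_{new}=c$ with $c\in\mathbb Q$; $\tau_{new}=\alpha+\beta$; $\tau_{new}=\alpha\cdot\beta$; $\tau_{new}=\alpha/\beta$, with the convention $a/0:=a$. - Boolean (values $0/1$, cell per cell): $(\alpha=\beta)$; $(\alpha<\beta)$; $(\ell=c)$ for a level $\ell$ of $\sigma(D_i)$ and $c\in dom(D_i.\ell)$, equal to $1$ iff $\rho(x_i,c)$; $(\ell<_\ell c)$, equal to $1$ iff $x_i$ rolls up to some $b\in dom(D_i.\ell)$ with $b<_\ell c$, where $<_\ell$ is any order defined on level $\ell$; similarly $(c<_\ell \ell)$. - Selectors: the constant selector $\sigma_{D_i.\ell=c}$, which equals the test $(\ell=c)$; the level selector $\sigma_{D_i.\ell}$, equal to $1$ iff $x_i=rep(b)$ for some $b\in dom(D_i.\ell)$, and $0$ otherwise. - Global aggregates (the same value in all non-empty cells): $\#_{\neq}(\alpha)$, the number of distinct values of $\alpha$ in the matrix; $\mathrm{SUM}_d(\alpha)$, the sum of $\alpha$ over all non-empty cells; $\min(\alpha)$; $\max(\alpha)$. - Grouped aggregates: if $\tau_m$ is a prime (product) labeling of the cells, then $\#_{\neq}|_{\tau_m}(\alpha)$, $\min|_{\tau_m}(\alpha)$ and $\max|_{\tau_m}(\alpha)$ are, in each cell $x$, the number of distinct values, minimum and maximum of $\alpha$ over the cells having the same label as $\tau_m(x)$. - Grouping: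 $\gamma_{D_i.\ell}$, where $dom(D_i.\ell)=\{b_1<\dots<b_s\}$: the next $s$ prime labels not yet used by earlier transformations are assigned in order to $b_1,\dots,b_s$, and a cell with $\rho(x_i,b_j)$ receives the label of $b_j$. Projection of a prime sum $\tau_m|_{\tau_n}$: if $\tau_m$ is a prime sum $\sum_w a_w w$ over the labels of an earlier prime (product) labeling $\tau_n$, the new measure has value $a_w$ in each cell where $\tau_n=w$. **OLAP operation (of arity $m$).** It is a finite sequence of $n$ atomic transformations creating $\tau_{l+1},\dots,\tau_{l+n}$, followed by the creation of a Boolean measure $\varphi^{(m)}$ (the output flag), optionally preceded by the creation of a Boolean measure $\delta$ (a destructor); $\delta$ and $\varphi^{(m)}$ are created by atomic transformations or set equal to existing Boolean measures. In the output cube, dimensions, schemas and dimension graphs are unchanged; cells with $\delta=0$ are emptied (even of their protected measures); in the other non-empty cells the measures are $\mu_1,\dots,\mu_k$, the last $m$ computed measures $\tau_{l+n-m+1},\dots,\tau_{l+n}$ (renamed $\tau_1,\dots,\tau_m$), and the new flag $\varphi^{(m)}$ replacing the old one. An operation on data cubes is expressible as an OLAP operation if there is an OLAP operation (its sequence of transformations being chosen from the parameters of the operation, the numbers of measures, and the dimension schemas and graphs) whose output on the input cube is the output of the operation. **Classical OLAP operations** on a data cube $\mathcal D$ (protected measures are kept in all cells that are not destroyed; sums and aggregates range over non-empty cells only): - $\mathsf{DICE}(\mathcal D,\phi)$: $\phi$ is a Boolean combination of conditions of the forms: (a) a selector on a value $b$ at a level $\ell$ of a dimension $D_i$ (i.e.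 $\rho(x_i,b)$); (b) $\ell<c$ or $c<\ell$ for a level $\ell$ of some $\sigma(D_i)$ and a constant $c\in dom(D_i.\ell)$; (c) $\alpha=c$, $\alpha<c$ or $c<\alpha$ for a measure $\alpha$ and $c\in\mathbb Q$. The cells satisfying $\phi$ are selected: they get flag $1$ and keep their measures; all other cells are destroyed. - $\mathsf{SLICE}(\mathcal D,D_i)$: the measures $\mu_1,\dots,\mu_k$ are ''replaced'' (as computed output measures) by $\mu_n^{\Sigma_i}(x_1,\dots,x_d)=\sum_{y\in dom(D_i)}\mu_n(x_1,\dots,x_{i-1},y,x_{i+1},\dots,x_d)$, $1\le n\le k$; all cells except those with $x_i=rep(all)$ in dimension $D_i$ are destroyed, and the remaining cells get flag $1$. - $\mathsf{SLICE\text{-}DICE}(\mathcal D,D_i,a)$ with $a\in dom(D_i)$: the cells with $x_i=a$ are kept with their measures and get flag $1$; all other cells are destroyed. - $\mathsf{ROLL\text{-}UP}(\mathcal D,D_i,H(\ell),\{(\alpha_j,f_j)\mid j=1,\dots,r\})$: $H$ is a hierarchy over $D_i$ ending in level $\ell$, the $\alpha_j$ are measures of $\mathcal D$ (protected or computed), and $f_j\in\{\mathsf{SUM},\mathsf{AVG},\mathsf{MIN},\mathsf{MAX},\mathsf{COUNT},\mathsf{COUNT\text{-}DISTINCT}\}$. It computes, as computed output measures, $\alpha_j^{f_j}(x_1,\dots,x_d)=f_j(\{\alpha_j(x_1,\dots,x_{i-1},y_i,x_{i+1},\dots,x_d)\mid y_i\in dom(D_i),\ \rho_H(y_i,b)\})$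 (a multiset), where $b\in dom(D_i.\ell)$ is such that $\rho_H(x_i,b)$. No cell is destroyed, and the output flag is $1$ exactly on the (non-empty) cells for which $x_i=rep(b)$ for some $b\in dom(D_i.\ell)$. - $\mathsf{DRILL\text{-}DOWN}(\mathcal D,D_i,H(\ell'\leftarrow\ell),\{(\alpha_j,f_j)\})$, for $\ell'$ a level below $\ell$ in $H$: by definition it has the same output as $\mathsf{ROLL\text{-}UP}(\mathcal D,D_i,H(\ell'),\{(\alpha_j,f_j)\})$. *)

(* Defs.v *)
From HB Require Import structures.
From mathcomp Require Import all_boot all_order all_algebra.
Set Implicit Arguments.
Unset Strict Implicit.
Unset Printing Implicit Defensive.
Import Order.TTheory GRing.Theory Num.Theory.
Local Open Scope ring_scope.

Section DimensionGraph.
Context {disp : Order.disp_t} {L : finTBLatticeType disp} {dom : L -> finType}.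

(* The lattice of levels as a directed graph: its Hasse diagram.  All is
   [\top] and Bottom is [\bot]. *)
Definition hasse : rel L :=
  fun l l' => (l < l')%O && [forall m, ~~ (l < m < l')%O].

(* A path [\bot :: H] of levels from Bottom to [l], given by its tail [H]. *)
Definition hierarchy_to (l : L) (H : seq L) : bool :=
  path hasse \bot%O H && (last \bot%O H == l).

(* A tagged union: elements of different levels are different nodes. *)
Definition node := {l : L & dom l}.
Definition mknode (l : L) (b : dom l) : node := Tagged (fun l => dom l) b.

Variable gedge : rel node.

Definition hier_graph (H : seq L) : rel node :=
  fun u v => [&& gedge u v, tag u \in \bot%O :: H & tag v \in \bot%O :: H].

(* Directed towards [r]: every node has exactly one directed path to [r]. *)
Definition directed_tree (H : seq L) (r : node) : Prop :=
  forall u : node, tag u \in \bot%O :: H ->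
    exists! p : seq node, path (hier_graph H) u p /\ last u p = r.

Definition rollup_in (H : seq L) (l l' : L) (a : dom l) (b : dom l') : bool :=
  [&& l \in \bot%O :: H, l' \in \bot%O :: H
    & connect (hier_graph H) (mknode a) (mknode b)].

(* Every path of the dimension graph that starts in dom(Bottom) follows a path
   of levels, so this is roll-up in some hierarchy reaching [l] ([rollupP]). *)
Definition rollup (l : L) (a : dom \bot%O) (b : dom l) : bool :=
  connect gedge (mknode a) (mknode b).

Lemma rollupP (gedge_cover : forall u v, gedge u v -> hasse (tag u) (tag v))
    (l : L) (a : dom \bot%O) (b : dom l) :
  reflect (exists2 H, hierarchy_to l H & rollup_in H a b) (rollup a b).
Proof.
apply: (iffP idP) => [/connectP[p gp lp]|[H hH /and3P[_ _ /connectP[p gp lp]]]]; last first.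
  by apply/connectP; exists p => //; apply: sub_path gp => u v /and3P[].
have tagp : all [pred u | tag u \in \bot%O :: map tag p] (mknode a :: p).
  apply/allP => u; rewrite !inE => /orP[/eqP->|/(map_f tag)->];
    by rewrite ?eqxx ?orbT.
exists (map tag p).
  rewrite /hierarchy_to -[X in path _ X](erefl (tag (mknode a))) path_map.
  rewrite -[X in last X _](erefl (tag (mknode a))) last_map -lp eqxx andbT.
  exact: sub_path gp.
rewrite /rollup_in mem_head /=; apply/andP; split.
  have /(allP tagp) : mknode b \in mknode a :: p by rewrite lp mem_last.
  by [].
apply/connectP; exists p => //; apply: sub_in_path tagp gp => u v /= tu tv guv.
by apply/and3P.
Qed.

End DimensionGraph.

(* Acyclicity of the dimension graph follows from [edge_cover]. *)
Record dimension := Dimension {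
  dim_disp : Order.disp_t;
  level : finTBLatticeType dim_disp;
  dom : level -> finType;
  base_le : rel (dom \bot%O);
  edge : rel (node (dom := dom));
  dom_gt0 : forall l, (0 < #|dom l|)%N;
  dom_all : #|dom \top%O| = 1%N;
  base_le_anti : antisymmetric base_le;
  base_le_trans : transitive base_le;
  base_le_total : total base_le;
  edge_cover : forall u v, edge u v -> hasse (tag u) (tag v);
  edge_tree : forall (H : seq level) (all : dom \top%O),
    hierarchy_to \top%O H -> directed_tree edge H (mknode all);
  edge_sound : forall (l : level) (H1 H2 : seq level) (a : dom \bot%O)
      (b1 b2 : dom l),
    hierarchy_to l H1 -> hierarchy_to l H2 ->
    rollup_in edge H1 a b1 -> rollup_in edge H2 a b2 -> b1 = b2;
  rollup_onto : forall (l : level) (b : dom l), exists a, rollup edge a b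
}.

Section Levels.
Variable D : dimension.

Definition base : finType := dom (\bot%O : level D).
Definition base_lt (a b : base) : bool := (a != b) && base_le a b.

Definition rho (l : level D) (a : base) (b : dom l) : bool := rollup (@edge D) a b.
Definition rho_in (H : seq (level D)) (l : level D) (a : base) (b : dom l) : bool :=
  rollup_in (@edge D) H a b.

(* The [base_le]-smallest element of dom(Bottom) that rolls up to [b]. *)
Definition rep (l : level D) (b : dom l) : base :=
  extremum (@base_le D) (xchoose (rollup_onto b)) (fun a => rho a b) id.
Definition level_lt (l : level D) (b1 b2 : dom l) : bool :=
  base_lt (rep b1) (rep b2).
Definition is_rep (l : level D) (a : base) : bool :=
  [exists b : dom l, a == rep b].

End Levels.

(* Minimum and maximum of the values listed in a non-empty sequence. *)
Definition seqmin (T : numDomainType) (s : seq T) : T :=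
  \big[Num.min/head 0 s]_(v <- s) v.
Definition seqmax (T : numDomainType) (s : seq T) : T :=
  \big[Num.max/head 0 s]_(v <- s) v.

Section Cubes.
Context {d : nat} (Dim : 'I_d -> dimension).

Definition cell := {dffun forall i : 'I_d, base (Dim i)}.

(* [x] with its i-th coordinate replaced by [y] *)
Definition upd (x : cell) (i : 'I_d) (y : base (Dim i)) : cell :=
  [ffun j => dfwith x y j].

Record content (k l : nat) := Content {
  mu : {ffun 'I_k -> rat};
  tau : {ffun 'I_l -> rat};
  flag : bool
}.

(* [None]: the cell is empty (destroyed). *)
Definition cube (k l : nat) := {ffun cell -> option (content k l)}.

(** Classical operations *)

Section Classical.
Variable k : nat.

Definition measure_of (l : nat) (a : 'I_k + 'I_l) (c : content k l) : rat :=
  match a with inl j => mu c j | inr j => tau c j end.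

Inductive cond (l : nat) : Type :=
| CRollup (i : 'I_d) (lv : level (Dim i)) (b : dom lv)
| CLevelLt (i : 'I_d) (lv : level (Dim i)) (c : dom lv)
| CLevelGt (i : 'I_d) (lv : level (Dim i)) (c : dom lv)
| CEq (a : 'I_k + 'I_l) (c : rat)
| CLt (a : 'I_k + 'I_l) (c : rat)
| CGt (a : 'I_k + 'I_l) (c : rat)
| CNot (p : cond l)
| CAnd (p q : cond l)
| COr (p q : cond l).

Fixpoint holds (l : nat) (p : cond l) (x : cell) (m : content k l) : bool :=
  match p with
  | CRollup i lv b => rho (x i) b
  | CLevelLt i lv c => [exists b : dom lv, rho (x i) b && level_lt b c]
  | CLevelGt i lv c => [exists b : dom lv, rho (x i) b && level_lt c b]
  | CEq a c => measure_of a m == c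
  | CLt a c => measure_of a m < c
  | CGt a c => c < measure_of a m
  | CNot p => ~~ holds p x m
  | CAnd p q => holds p x m && holds q x m
  | COr p q => holds p x m || holds q x m
  end.

Definition dice_out (l : nat) (p : cond l) (D : cube k l) : cube k l :=
  [ffun x => if D x is Some m then
     if holds p x m then Some (Content (mu m) (tau m) true) else None
   else None].

Definition slice_out (l : nat) (i : 'I_d) (D : cube k l) : cube k k :=
  [ffun x => if D x is Some m then
     if is_rep \top%O (x i) then
       Some (Content (mu m)
         [ffun n => \sum_(y : base (Dim i))
            (if D (upd x y) is Some m' then mu m' n else 0)] true)
     else None
   else None].

Definition slice_dice_out (l : nat) (i : 'I_d) (a : base (Dim i)) (D : cube k l) :
    cube k l :=
  [ffun x => if D x is Some m then
     if x i == a then Some (Content (mu m) (tau m) true) else None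
   else None].

Inductive aggregate := Sum | Avg | Min | Max | Count | CountDistinct.

(* The sequence lists a non-empty multiset of rationals. *)
Definition agg (f : aggregate) (s : seq rat) : rat :=
  match f with
  | Sum => \sum_(v <- s) v
  | Avg => (\sum_(v <- s) v) / (size s)%:R
  | Min => seqmin s
  | Max => seqmax s
  | Count => (size s)%:R
  | CountDistinct => (size (undup s))%:R
  end.

(* Values of [a] in the non-empty cells that agree with [x] outside dimension
   [i] and whose i-th coordinate rolls up in [H] to the same element of level
   [lv] as [x i]. *)
Definition group_values (l : nat) (D : cube k l) (i : 'I_d)
    (H : seq (level (Dim i))) (lv : level (Dim i)) (a : 'I_k + 'I_l) (x : cell) :
    seq rat :=
  pmap (fun y : base (Dim i) => omap (measure_of a) (D (upd x y)))
    [seq y <- enum (base (Dim i)) |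
       [exists b : dom lv, rho_in H (x i) b && rho_in H y b]].

Definition roll_up_out (l : nat) (i : 'I_d) (lv : level (Dim i))
    (H : seq (level (Dim i))) (r : nat) (af : r.-tuple (('I_k + 'I_l) * aggregate))
    (D : cube k l) : cube k r :=
  [ffun x => if D x is Some m then
     Some (Content (mu m)
       [ffun j => agg (tnth af j).2 (group_values D H lv (tnth af j).1 x)]
       (is_rep lv (x i)))
   else None].

(* The first levels of the hierarchy [\bot :: H], up to [lv]. *)
Definition hier_upto (i : 'I_d) (H : seq (level (Dim i))) (lv : level (Dim i)) :
    seq (level (Dim i)) :=
  take (index lv (\bot%O :: H)) H.

Inductive classical (l : nat) : Type :=
| Dice (p : cond l)
| Slice (i : 'I_d)
| SliceDice (i : 'I_d) (a : base (Dim i))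
| RollUp (i : 'I_d) (lv : level (Dim i)) (H : seq (level (Dim i)))
    (Hlv : hierarchy_to lv H)
    (r : nat) (af : r.-tuple (('I_k + 'I_l) * aggregate))
| DrillDown (i : 'I_d) (lv' lv : level (Dim i)) (H : seq (level (Dim i)))
    (Hlv : hierarchy_to lv H) (Hlv' : lv' \in \bot%O :: H) (below : lv' != lv)
    (r : nat) (af : r.-tuple (('I_k + 'I_l) * aggregate)).

(* Number of computed measures of the output. *)
Definition arity (l : nat) (C : classical l) : nat :=
  match C with
  | Dice _ => l
  | Slice _ => k
  | SliceDice _ _ => l
  | RollUp _ _ _ _ r _ => r
  | DrillDown _ _ _ _ _ _ _ r _ => r
  end.

Definition classical_out (l : nat) (C : classical l) : cube k l -> cube k (arity C) :=
  match C return cube k l -> cube k (arity C) with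
  | Dice p => dice_out p
  | Slice i => @slice_out l i
  | SliceDice _ a => slice_dice_out a
  | RollUp _ lv H _ _ af => roll_up_out lv H af
  | DrillDown _ lv' _ H _ _ _ _ af => roll_up_out lv' (hier_upto H lv') af
  end.

Inductive classical_seq : nat -> nat -> Type :=
| CNil l : classical_seq l l
| CCons l n (C : classical l) (Cs : classical_seq (arity C) n) : classical_seq l n.

Fixpoint classical_seq_out (l n : nat) (Cs : classical_seq l n) :
    cube k l -> cube k n :=
  match Cs in classical_seq l n return cube k l -> cube k n with
  | CNil _ => id
  | CCons _ _ C Cs => fun D => classical_seq_out Cs (classical_out C D)
  end.

End Classical.

(** Atomic transformations *)

Section Syntax.
Variable k : nat.

(* A protected measure, or the computed measure of a given (0-based) index. *)
Definition mref : Type := 'I_k + nat.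

(* [TLevelEq] is both the test (l = c) and the constant selector. *)
Inductive atomic : Type :=
| TConst (c : rat)
| TAdd (a b : mref)
| TMul (a b : mref)
| TDiv (a b : mref)
| TEq (a b : mref)
| TLt (a b : mref)
| TLevelEq (i : 'I_d) (lv : level (Dim i)) (c : dom lv)
| TLevelLt (i : 'I_d) (lv : level (Dim i)) (lt : rel (dom lv))
    (_ : irreflexive lt) (_ : transitive lt) (c : dom lv)
| TLevelGt (i : 'I_d) (lv : level (Dim i)) (lt : rel (dom lv))
    (_ : irreflexive lt) (_ : transitive lt) (c : dom lv)
| TLevelSel (i : 'I_d) (lv : level (Dim i))
| TDistinct (a : mref)
| TSum (a : mref)
| TMin (a : mref)
| TMax (a : mref)
| TDistinctBy (n a : mref)
| TMinBy (n a : mref)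
| TMaxBy (n a : mref)
| TGroup (i : 'I_d) (lv : level (Dim i))
| TProj (m n : mref).

(* A Boolean measure is created by a transformation or is an existing measure. *)
Definition source : Type := atomic + mref.

Record olap_op (l m : nat) := OlapOp {
  steps : seq atomic;
  destructor : option source;
  output_flag : source;
  arity_le : (m <= l + size steps)%N
}.

Inductive olap_seq : nat -> nat -> Type :=
| ONil l : olap_seq l l
| OCons l m n (O : olap_op l m) (Os : olap_seq m n) : olap_seq l n.

End Syntax.

(** Semantics.  Intermediate measures have values in a real closed field [R],
    such as the real numbers. *)

Lemma exists_prime_above (m : nat) : exists p, (m < p)%N && prime p.
Proof. by have [p lt_mp pr_p] := prime_above m; exists p; rewrite lt_mp. Qed.

Fixpoint nth_prime (n : nat) : nat :=
  if n is n'.+1 then ex_minn (exists_prime_above (nth_prime n')) else 2.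

Section Semantics.
Variables (R : rcfType) (k : nat).

Definition prime_label (n : nat) : R :=
  if n is n'.+1 then Num.sqrt (nth_prime n')%:R else 1.

(* Values at empty cells, i.e. outside [nonempty], are junk and never used.
   A computed measure comes with the set of dimensions that it labels if it is
   a prime (product) labeling.  [used] counts the prime labels already used. *)
Record state := State {
  nonempty : {set cell};
  protected : 'I_k -> cell -> R;
  computed : seq ((cell -> R) * option {set 'I_d});
  used : nat
}.

Definition read (st : state) (a : mref k) : option (cell -> R) :=
  match a with inl j => Some (protected st j) | inr n => omap fst (onth (computed st) n) end.

Definition labeling (st : state) (a : mref k) : option {set 'I_d} :=
  match a with inl _ => None | inr n => obind snd (onth (computed st) n) end.

(* Labelings created by different [TGroup] use disjoint sets of labels. *)
Definition new_labeling (st : state) (t : atomic k) : option {set 'I_d} :=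
  match t with
  | TGroup i _ => Some [set i]
  | TMul a b =>
      match labeling st a, labeling st b with
      | Some I1, Some I2 => if [disjoint I1 & I2] then Some (I1 :|: I2) else None
      | _, _ => None
      end
  | _ => None
  end.

Definition reading (st : state) (a : mref k) (P : (cell -> R) -> Prop) : Prop :=
  if read st a is Some f then P f else False.

Definition reading_label (st : state) (a : mref k) (P : (cell -> R) -> Prop) : Prop :=
  isSome (labeling st a) /\ reading st a P.

Definition values (A : {set cell}) (f : cell -> R) : seq R := [seq f x | x in A].

Definition same_label (A : {set cell}) (g : cell -> R) (x : cell) : {set cell} :=
  [set y in A | g y == g x].

Definition distinct (A : {set cell}) (f : cell -> R) : R :=
  (size (undup (values A f)))%:R.

(* 0-based position of [b] in the enumeration of its level by [level_lt] *)
Definition level_rank (i : 'I_d) (lv : level (Dim i)) (b : dom lv) : nat :=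
  #|[set b' : dom lv | level_lt b' b]|.

(* [v] is the new measure created by [t]; only its values in the non-empty
   cells matter.  In [TProj], the coefficients are unique because the labels
   that occur are linearly independent over the rationals. *)
Definition creates (st : state) (t : atomic k) (v : cell -> R) : Prop :=
  let A := nonempty st in
  match t with
  | TConst c => {in A, forall x, v x = ratr c}
  | TAdd a b => reading st a (fun f => reading st b (fun g =>
      {in A, forall x, v x = f x + g x}))
  | TMul a b => reading st a (fun f => reading st b (fun g =>
      {in A, forall x, v x = f x * g x}))
  | TDiv a b => reading st a (fun f => reading st b (fun g =>
      {in A, forall x, v x = if g x == 0 then f x else f x / g x}))
  | TEq a b => reading st a (fun f => reading st b (fun g =>
      {in A, forall x, v x = (f x == g x)%:R}))
  | TLt a b => reading st a (fun f => reading st b (fun g =>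
      {in A, forall x, v x = (f x < g x)%R%:R}))
  | TLevelEq i lv c => {in A, forall x, v x = (rho (x i) c)%:R}
  | TLevelLt i lv lt _ _ c =>
      {in A, forall x, v x = [exists b : dom lv, rho (x i) b && lt b c]%:R}
  | TLevelGt i lv lt _ _ c =>
      {in A, forall x, v x = [exists b : dom lv, rho (x i) b && lt c b]%:R}
  | TLevelSel i lv => {in A, forall x, v x = (is_rep lv (x i))%:R}
  | TDistinct a => reading st a (fun f => {in A, forall x, v x = distinct A f})
  | TSum a => reading st a (fun f => {in A, forall x, v x = \sum_(y in A) f y})
  | TMin a => reading st a (fun f => {in A, forall x, v x = seqmin (values A f)})
  | TMax a => reading st a (fun f => {in A, forall x, v x = seqmax (values A f)})
  | TDistinctBy n a => reading_label st n (fun g => reading st a (fun f =>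
      {in A, forall x, v x = distinct (same_label A g x) f}))
  | TMinBy n a => reading_label st n (fun g => reading st a (fun f =>
      {in A, forall x, v x = seqmin (values (same_label A g x) f)}))
  | TMaxBy n a => reading_label st n (fun g => reading st a (fun f =>
      {in A, forall x, v x = seqmax (values (same_label A g x) f)}))
  | TGroup i lv => {in A, forall x : cell, exists2 b : dom lv,
      rho (x i) b & v x = prime_label (used st + level_rank b)}
  | TProj m n => reading_label st n (fun g => reading st m (fun f =>
      exists a : R -> rat,
        {in A, forall x, f x = \sum_(w <- undup (values A g)) ratr (a w) * w} /\
        {in A, forall x, v x = ratr (a (g x))}))
  end.

Definition push (st : state) (v : cell -> R) (lab : option {set 'I_d}) (s : nat) :
    state :=
  State (nonempty st) (@protected st) (rcons (computed st) (v, lab)) (used st + s).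

Definition push_atomic (st : state) (t : atomic k) (v : cell -> R) : state :=
  push st v (new_labeling st t)
    (if t is TGroup i lv then #|dom lv| else 0).

Fixpoint exec (st : state) (ts : seq (atomic k)) (st' : state) : Prop :=
  if ts is t :: ts' then
    exists2 v, creates st t v & exec (push_atomic st t v) ts' st'
  else st' = st.

Definition creates_bool (st : state) (s : source k) (v : cell -> R) : Prop :=
  {in nonempty st, forall x, v x = 0 \/ v x = 1} /\
  match s with
  | inl t => creates st t v
  | inr a => reading st a (fun f => {in nonempty st, forall x, v x = f x})
  end.

Definition push_source (st : state) (s : source k) (v : cell -> R) : state :=
  match s with
  | inl t => push_atomic st t v
  | inr a => push st v (labeling st a) 0
  end.

Definition init (l : nat) (D : cube k l) : state :=
  State [set x | isSome (D x)]
    (fun j x => if D x is Some m then ratr (mu m j) else 0)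
    [seq (fun x => if D x is Some m then ratr (tau m j) else 0, None) | j : 'I_l]
    0.

(* The measures [st.tau_(l+n-m+j+1)], [j < m], where [l+n] is the number of
   computed measures, are the computed measures of the output. *)
Definition out_measure (st : state) (m j : nat) : cell -> R :=
  (nth (fun=> 0, None) (computed st) (size (computed st) - m + j)).1.

(* [delta] is the destructor, constantly 1 if there is none.  The output must
   be a data cube, i.e. have rational-valued measures. *)
Definition olap_run (l m : nat) (O : olap_op k l m) (D : cube k l) (D' : cube k m) :
    Prop :=
  exists (st st' : state) (delta phi : cell -> R),
  [/\ exec (init D) (steps O) st,
      match destructor O with
      | Some s => creates_bool st s delta /\ st' = push_source st s delta
      | None => (forall x, delta x = 1) /\ st' = st
      end,
      creates_bool st' (output_flag O) phi
    & forall x : cell,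
      if D x is Some c then
        if delta x == 0 then D' x = None else
        exists2 t : {ffun 'I_m -> rat},
          forall j : 'I_m, ratr (t j) = out_measure st m j x
          & D' x = Some (Content (mu c) t (phi x == 1))
      else D' x = None].

Fixpoint olap_seq_run (l n : nat) (Os : olap_seq k l n) :
    cube k l -> cube k n -> Prop :=
  match Os in olap_seq _ l n return cube k l -> cube k n -> Prop with
  | ONil _ => fun D D' => D' = D
  | OCons _ _ _ op Os => fun D D'' =>
      exists2 D', olap_run op D D' & olap_seq_run Os D' D''
  end.

(* The operation is chosen before the input cube.  The equivalence says that it
   can be run on every cube and that [F D] is its only possible output. *)
Definition expressible (l m : nat) (F : cube k l -> cube k m) : Prop :=
  exists O : olap_op k l m, forall D D', olap_run O D D' <-> D' = F D.

Definition expressible_by_seq (l n : nat) (F : cube k l -> cube k n) : Prop :=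
  exists Os : olap_seq k l n, forall D D', olap_seq_run Os D D' <-> D' = F D.

End Semantics.
End Cubes.

(* Main.v *)
(* No prime labels are needed, because the sequence of transformations may depend
   on the dimension graphs.  The product of the selectors [D_i.Bottom = c_i] is
   the indicator of the cell [c], so a measure that depends on the cell [x] both
   as a parameter and as a position is the sum over all [c] of the indicator of
   [c] times the measure with parameter [c].  In this way every function of the
   cells that does not depend on the measures is obtained by arithmetic, and an
   aggregate over the group of [x] reduces to global aggregates, one for each
   [c], of measures altered outside the group of [c].  All values stay rational,
   and every step is determined on the non-empty cells. *)

Require Import Defs.
From mathcomp Require Import all_boot all_order all_algebra.
Set Implicit Arguments.
Unset Strict Implicit.
Unset Printing Implicit Defensive.

Import Order.TTheory GRing.Theory Num.Theory.

(** * Extrema of finite sequences, and aggregates of multisets *)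

Section Extrema.
Local Open Scope ring_scope.
Variable T : realDomainType.
Implicit Types (s : seq T) (v : T).

Lemma seqmin_mem s : s != [::] -> seqmin s \in s.
Proof.
case: s => // v s _; rewrite /seqmin big_seq.
apply: (big_ind [in v :: s]) => //=; first exact: mem_head.
by move=> x y xs ys; case: leP.
Qed.

Lemma seqmax_mem s : s != [::] -> seqmax s \in s.
Proof.
case: s => // v s _; rewrite /seqmax big_seq.
apply: (big_ind [in v :: s]) => //=; first exact: mem_head.
by move=> x y xs ys; case: leP.
Qed.

Lemma seqmin_le s v : v \in s -> seqmin s <= v.
Proof.
rewrite /seqmin; elim: s (head 0 s) => //= w s IH u; rewrite inE big_cons ge_min.
by case/predU1P => [->|/IH->]; rewrite ?lexx ?orbT.
Qed.

Lemma seqmax_ge s v : v \in s -> v <= seqmax s.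
Proof.
rewrite /seqmax; elim: s (head 0 s) => //= w s IH u; rewrite inE big_cons le_max.
by case/predU1P => [->|/IH->]; rewrite ?lexx ?orbT.
Qed.

Lemma seqmin_eq s v : v \in s -> (forall w, w \in s -> v <= w) -> seqmin s = v.
Proof.
move=> vs v_le; apply/le_anti; rewrite seqmin_le // v_le // seqmin_mem //.
by apply: contraTneq vs => ->.
Qed.

Lemma seqmax_eq s v : v \in s -> (forall w, w \in s -> w <= v) -> seqmax s = v.
Proof.
move=> vs v_ge; apply/le_anti; rewrite seqmax_ge // v_ge // seqmax_mem //.
by apply: contraTneq vs => ->.
Qed.

Lemma eq_seqmin s t : s =i t -> seqmin s = seqmin t.
Proof.
move=> st; have [t0|tn0] := eqVneq t [::].
  by case: s st => [|v s]; rewrite t0 // => /(_ v); rewrite mem_head.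
apply: seqmin_eq => [|w]; rewrite st; [exact: seqmin_mem | exact: seqmin_le].
Qed.

Lemma eq_seqmax s t : s =i t -> seqmax s = seqmax t.
Proof.
move=> st; have [t0|tn0] := eqVneq t [::].
  by case: s st => [|v s]; rewrite t0 // => /(_ v); rewrite mem_head.
apply: seqmax_eq => [|w]; rewrite st; [exact: seqmax_mem | exact: seqmax_ge].
Qed.

End Extrema.

Lemma eq_size_undup (T : eqType) (s t : seq T) :
  s =i t -> size (undup s) = size (undup t).
Proof.
move=> st; apply/perm_size/uniq_perm; rewrite ?undup_uniq // => x.
by rewrite !mem_undup.
Qed.

(** Aggregates are defined on lists but applied to multisets, so a group may be enumerated in any
    order. [Min], [Max] and [CountDistinct] see only the set of values. *)
Lemma perm_agg (f : aggregate) (s t : seq rat) :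
  perm_eq s t -> agg f s = agg f t.
Proof.
move=> st; have eq_st := perm_mem st; case: f => /=.
- exact: perm_big.
- by rewrite (perm_big _ st) (perm_size st).
- exact: eq_seqmin.
- exact: eq_seqmax.
- by rewrite (perm_size st).
- by rewrite (eq_size_undup eq_st).
Qed.

(** * Extrema under the embedding of the rationals *)

Section RationalValues.
Local Open Scope ring_scope.
Variable R : rcfType.

Lemma ratr_seqmin (s : seq rat) : seqmin [seq ratr v : R | v <- s] =
  ratr (seqmin s).
Proof.
(* On the empty sequence both sides are the default value 0. *)
have [->|sn0] := eqVneq s [::]; first by rewrite /seqmin !big_nil rmorph0.
apply: seqmin_eq => [|_ /mapP[v vs ->]]; first exact/map_f/seqmin_mem.
by rewrite ler_rat seqmin_le.
Qed.

Lemma ratr_seqmax (s : seq rat) : seqmax [seq ratr v : R | v <- s] =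
  ratr (seqmax s).
Proof.
have [->|sn0] := eqVneq s [::]; first by rewrite /seqmax !big_nil rmorph0.
apply: seqmax_eq => [|_ /mapP[v vs ->]]; first exact/map_f/seqmax_mem.
by rewrite ler_rat seqmax_ge.
Qed.

End RationalValues.

(** Every edge of the dimension graph strictly raises the level, so a non-trivial path that leaves
    Bottom cannot end in Bottom. *)
Lemma rho_bot (D : dimension) (a b : base D) : rho a b = (a == b).
Proof.
apply/connectP/eqP => [[p gp lp]|->]; last by exists [::].
have lt_p : path (fun m n => (m < n)%O) \bot%O (map tag p).
  rewrite -[X in path _ X](erefl (tag (mknode a))) path_map.
  by apply: sub_path gp => u v /edge_cover/andP[].
case: p => [|u p] in lp lt_p gp *.
  by apply/eqP; move/eqP: lp; rewrite eq_Tagged eq_sym.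
have /allP/(_ _ (map_f tag (mem_last u p))) := order_path_min lt_trans lt_p.
by rewrite -[last u p]lp /= ltxx.
Qed.

(** * Runs of transformations and the measures they create *)

Section Execution.
Local Open Scope ring_scope.
Variables (R : rcfType) (d : nat) (Dim : 'I_d -> dimension) (k : nat).
Implicit Types (st : state Dim R k) (t : atomic Dim k) (ts : seq (atomic Dim k))
  (a : mref k) (F G : cell Dim -> rat).

(** Transformations only append to the list of computed measures, so a reference by position keeps
    its meaning in every later state. *)
Definition extends st st' : Prop :=
  [/\ nonempty st' = nonempty st, @protected _ _ _ _ st' = @protected _ _ _ _ st
    & exists s, computed st' = computed st ++ s].

(** A dangling reference represents nothing, since [reading] is then false. Requiring [F] to be
    rational-valued is what later makes the output a data cube. *)
Definition represents st a F : Prop :=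
  reading st a (fun f => {in nonempty st, forall x, f x = ratr (F x)}).

Lemma extends_refl st : extends st st.
Proof. by split=> //; exists [::]; rewrite cats0. Qed.

Lemma extends_trans st2 st1 st3 :
  extends st1 st2 -> extends st2 st3 -> extends st1 st3.
Proof.
case=> n12 p12 [s12 c12] [n23 p23 [s23 c23]]; split; rewrite ?n23 ?p23 //.
by exists (s12 ++ s23); rewrite c23 c12 catA.
Qed.

Lemma extends_push st v lab s : extends st (push st v lab s).
Proof. by split=> //; exists [:: (v, lab)]; rewrite /= cats1. Qed.

Lemma extends_exec st ts st' : exec st ts st' -> extends st st'.
Proof.
elim: ts st => [|t ts IH] st /=; first by move->; exact: extends_refl.
by case=> v _ /IH; apply: extends_trans; exact: extends_push.
Qed.

Lemma size_exec st ts st' :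
  exec st ts st' -> size (computed st') = (size (computed st) + size ts)%N.
Proof.
elim: ts st => [|t ts IH] st /=; first by move->; rewrite addn0.
by case=> v _ /IH ->; rewrite size_rcons addSnnS.
Qed.

Lemma exec_cat st ts1 ts2 st' :
  exec st (ts1 ++ ts2) st' <-> exists2 st1, exec st ts1 st1 & exec st1 ts2 st'.
Proof.
elim: ts1 st => [|t ts1 IH] st /=; first by split=> [|[_ ->]] //; exists st.
split=> [[v cv /IH[st1 e1 e2]]|[st1 [v cv e1] e2]].
  by exists st1 => //; exists v.
by exists v => //; apply/IH; exists st1.
Qed.

Lemma represents_extends st st' a F :
  extends st st' -> represents st a F -> represents st' a F.
Proof.
case=> nst' pst' [s cst']; case: a => [j|n]; rewrite /represents /reading /read nst'.
  by rewrite pst'.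
by rewrite cst' onth_cat -onthTE; case: (onth _ n).
Qed.

Lemma represents_push st v lab s F :
  represents (push st v lab s) (inr (size (computed st))) F <->
  {in nonempty st, forall x, v x = ratr (F x)}.
Proof.
by rewrite /represents /reading /read /= -cats1 onth_cat ltnn subnn.
Qed.

End Execution.

(** * Measures definable by transformations *)

Section Definable.
Local Open Scope ring_scope.
Variables (R : rcfType) (d : nat) (Dim : 'I_d -> dimension) (k l : nat).
Implicit Types (D : cube Dim k l) (F G : cube Dim k l -> cell Dim -> rat).
Implicit Types (B : cube Dim k l -> cell Dim -> bool).

Definition live D : {set cell Dim} := [set x | isSome (D x)].

(* The length [N] of the list of computed measures is fixed in advance because
   transformations refer to computed measures by their position in this list. *)
Definition definable F : Prop :=
  forall N, exists ts (a : mref k), forall D (st : state Dim R k),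
    extends (init R D) st -> size (computed st) = N ->
    (exists st', exec st ts st') /\
    (forall st', exec st ts st' -> represents st' a (F D)).

(** Both [creates] and [represents] constrain values in non-empty cells only, so a definable measure
    may be rewritten freely on those cells. *)
Lemma eq_definable F G :
  (forall D, {in live D, F D =1 G D}) -> definable F -> definable G.
Proof.
move=> FG dF N; have [ts [a tsP]] := dF N; exists ts, a => D st Dst szst.
have [ex rF] := tsP D st Dst szst; split=> // st' est'.
have := rF st' est'; have [nst' _ _] := extends_trans Dst (extends_exec est').
rewrite /represents /reading; case: read => // f fF x xA.
by rewrite fF // FG // -[live D]nst'.
Qed.

(** The equivalence serves twice: from right to left it provides a run, from left to right it shows
    that every run creates this measure. *)
Lemma definable_step0 (t : atomic Dim k) F :
  (forall D (st : state Dim R k) v, nonempty st = live D ->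
     creates st t v <-> {in nonempty st, forall x, v x = ratr (F D x)}) ->
  definable F.
Proof.
move=> tP N; exists [:: t], (inr N) => D st Dst szst; have [nst _ _] := Dst.
split=> [|_ [v cv ->]].
  by eexists; exists (fun x => ratr (F D x)); [apply/(tP D _ _ nst)|].
by rewrite -szst; apply/represents_push/(tP D _ _ nst).
Qed.

(** [op] receives the set of non-empty cells and whole measures, not just two values, so that global
    aggregates are covered too. The second sequence is chosen for a list already lengthened by the
    first. *)
Lemma definable_step2 (t : mref k -> mref k -> atomic Dim k)
    (op : {set cell Dim} -> (cell Dim -> rat) -> (cell Dim -> rat) ->
       cell Dim -> rat) F G :
  (forall (st : state Dim R k) a b f g v,
     represents st a f -> represents st b g ->
     creates st (t a b) v <->
     {in nonempty st, forall x, v x = ratr (op (nonempty st) f g x)}) ->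
  definable F -> definable G -> definable (fun D => op (live D) (F D) (G D)).
Proof.
move=> tP dF dG N; have [ts1 [a ts1P]] := dF N.
have [ts2 [b ts2P]] := dG (N + size ts1)%N.
(* The result is appended last, so its 0-based position is the number of measures present before
   it. *)
exists (ts1 ++ (ts2 ++ [:: t a b])), (inr (N + size ts1 + size ts2)%N) => D st Dst szst.
have [[st1 e1] r1] := ts1P D st Dst szst.
have after1 st1' : exec st ts1 st1' ->
    extends (init R D) st1' /\ size (computed st1') = (N + size ts1)%N.
  move=> e1'; split; first exact: extends_trans Dst (extends_exec e1').
  by rewrite (size_exec e1') szst.
have both st1' st2' : exec st ts1 st1' -> exec st1' ts2 st2' ->
    [/\ represents st2' a (F D), represents st2' b (G D), nonempty st2' = live D
      & size (computed st2') = (N + size ts1 + size ts2)%N].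
  move=> e1' e2'; have [D1 sz1] := after1 _ e1'.
  have [_ r2] := ts2P D _ D1 sz1.
  have [n2 _ _] := extends_trans D1 (extends_exec e2').
  rewrite (size_exec e2') sz1; split=> //; last exact: r2.
  exact/(represents_extends (extends_exec e2'))/r1.
split=> [|_ /exec_cat[st1' e1' /exec_cat[st2' e2' [v cv ->]]]].
  have [D1 sz1] := after1 _ e1; have [[st2 e2] _] := ts2P D _ D1 sz1.
  have [ra rb n2 sz2] := both _ _ e1 e2.
  eexists; apply/exec_cat; exists st1 => //; apply/exec_cat; exists st2 => //.
  exists (fun x => ratr (op (live D) (F D) (G D) x)) => //.
  by apply/(tP _ _ _ _ _ _ ra rb); rewrite n2.
have [ra rb n2 sz2] := both _ _ e1' e2'.
by rewrite -sz2; apply/represents_push; rewrite -n2; apply/(tP _ _ _ _ _ _ ra rb).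
Qed.

Lemma definable_step1 (t : mref k -> atomic Dim k)
    (op : {set cell Dim} -> (cell Dim -> rat) -> cell Dim -> rat) F :
  (forall (st : state Dim R k) a f v, represents st a f ->
     creates st (t a) v <->
     {in nonempty st, forall x, v x = ratr (op (nonempty st) f x)}) ->
  definable F -> definable (fun D => op (live D) (F D)).
Proof.
move=> tP dF.
(* A unary transformation is a binary one that ignores its second operand. *)
apply: (@definable_step2 (fun a _ => t a) (fun A f _ => op A f) F F) => //.
by move=> st a b f g v ra _; apply: tP.
Qed.

Lemma definable_mu j :
  definable (fun D x => if D x is Some c then mu c j else 0).
Proof.
move=> N; exists [::], (inl j) => D st [nst pst _] _.
split=> [|_ ->]; first by exists st.
by rewrite /represents /reading /= pst /= => x _; case: (D x); rewrite ?rmorph0.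
Qed.

Lemma definable_tau j :
  definable (fun D x => if D x is Some c then tau c j else 0).
Proof.
move=> N; exists [::], (inr (nat_of_ord j)) => D st [nst _ [s cst]] _.
split=> [|_ ->]; first by exists st.
rewrite /represents /reading /= cst /= onth_cat size_map -cardE card_ord ltn_ord.
(* As [j < l], position [j] lies in the initial part of the list, which holds the input measures. *)
rewrite /image_mem onth_map onthE (nth_map j) ?size_enum_ord // nth_ord_enum /=.
by move=> x _ /=; case: (D x); rewrite ?rmorph0.
Qed.

Lemma definable_const c : definable (fun _ _ => c).
Proof. exact: (@definable_step0 (TConst Dim k c)). Qed.

Let reading2 (st : state Dim R k) (a b : mref k) f g
    (P : (cell Dim -> R) -> (cell Dim -> R) -> Prop) (Q : Prop) :
  (forall f' g', {in nonempty st, forall x, f' x = ratr (f x)} ->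
     {in nonempty st, forall x, g' x = ratr (g x)} -> P f' g' <-> Q) ->
  represents st a f -> represents st b g ->
  reading st a (fun f' => reading st b (P f')) <-> Q.
Proof.
rewrite /represents /reading.
by case: (read st a) => // f'; case: (read st b) => // g' H /H{}H /H.
Qed.

Lemma eq_in_iff (T : Type) (A : {set cell Dim}) (v f g : cell Dim -> T) :
  {in A, f =1 g} ->
  {in A, forall x, v x = f x} <-> {in A, forall x, v x = g x}.
Proof. by move=> fg; split=> vP x xA; rewrite vP // fg. Qed.

(** * Arithmetic and comparisons *)

Lemma definable_add F G :
  definable F -> definable G -> definable (fun D x => F D x + G D x).
Proof.
apply: (@definable_step2 (@TAdd _ _ _) (fun _ f g x => f x + g x)) => st a b f g v.
apply: reading2 => f' g' f'P g'P; apply: eq_in_iff => x xA.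
by rewrite f'P // g'P // rmorphD.
Qed.

Lemma definable_mul F G :
  definable F -> definable G -> definable (fun D x => F D x * G D x).
Proof.
apply: (@definable_step2 (@TMul _ _ _) (fun _ f g x => f x * g x)) => st a b f g v.
apply: reading2 => f' g' f'P g'P; apply: eq_in_iff => x xA.
by rewrite f'P // g'P // rmorphM.
Qed.

Lemma definable_div F G : definable F -> definable G ->
  definable (fun D x => if G D x == 0 then F D x else F D x / G D x).
Proof.
apply: (@definable_step2 (@TDiv _ _ _)
  (fun _ f g x => if g x == 0 then f x else f x / g x)) => st a b f g v.
apply: reading2 => f' g' f'P g'P; apply: eq_in_iff => x xA.
by rewrite f'P // g'P // fmorph_eq0; case: eqP => // _; rewrite fmorph_div.
Qed.

Lemma definable_eq F G :
  definable F -> definable G -> definable (fun D x => (F D x == G D x)%:R).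
Proof.
apply: (@definable_step2 (@TEq _ _ _) (fun _ f g x => (f x == g x)%:R)) => st a b f g v.
apply: reading2 => f' g' f'P g'P; apply: eq_in_iff => x xA.
by rewrite f'P // g'P // ratr_nat (inj_eq (fmorph_inj _)).
Qed.

Lemma definable_lt F G :
  definable F -> definable G -> definable (fun D x => (F D x < G D x)%R%:R).
Proof.
apply: (@definable_step2 (@TLt _ _ _) (fun _ f g x => (f x < g x)%R%:R)) => st a b f g v.
apply: reading2 => f' g' f'P g'P; apply: eq_in_iff => x xA.
by rewrite f'P // g'P // ratr_nat ltr_rat.
Qed.

Let reading1 (st : state Dim R k) (a : mref k) f
    (P : (cell Dim -> R) -> Prop) (Q : Prop) :
  (forall f', {in nonempty st, forall x, f' x = ratr (f x)} -> P f' <-> Q) ->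
  represents st a f -> reading st a P <-> Q.
Proof. by rewrite /represents /reading; case: (read st a) => // f' H /H. Qed.

Lemma values_ratr (A : {set cell Dim}) (f' : cell Dim -> R) f :
  {in A, forall x, f' x = ratr (f x)} ->
  values A f' = map ratr [seq f x | x in A].
Proof.
by move=> f'P; rewrite -map_comp; apply/eq_in_map => x; rewrite mem_enum => /f'P.
Qed.

(** * Global aggregates *)

Lemma definable_sum F :
  definable F -> definable (fun D _ => \sum_(y in live D) F D y).
Proof.
apply: (@definable_step1 (@TSum _ _ _) (fun A f _ => \sum_(y in A) f y)) => st a f v.
apply: reading1 => f' f'P; apply: eq_in_iff => x xA.
by rewrite rmorph_sum; apply: eq_bigr => y /f'P.
Qed.

Lemma definable_min F :
  definable F -> definable (fun D _ => seqmin [seq F D y | y in live D]).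
Proof.
apply: (@definable_step1 (@TMin _ _ _) (fun A f _ => seqmin [seq f y | y in A])) => st a f v.
apply: reading1 => f' f'P; apply: eq_in_iff => x xA.
by rewrite (values_ratr f'P) ratr_seqmin.
Qed.

Lemma definable_max F :
  definable F -> definable (fun D _ => seqmax [seq F D y | y in live D]).
Proof.
apply: (@definable_step1 (@TMax _ _ _) (fun A f _ => seqmax [seq f y | y in A])) => st a f v.
apply: reading1 => f' f'P; apply: eq_in_iff => x xA.
by rewrite (values_ratr f'P) ratr_seqmax.
Qed.

Lemma definable_distinct F :
  definable F -> definable (fun D _ => (size (undup [seq F D y | y in live D]))%:R).
Proof.
apply: (@definable_step1 (@TDistinct _ _ _)
  (fun A f _ => (size (undup [seq f y | y in A]))%:R)) => st a f v.
apply: reading1 => f' f'P; apply: eq_in_iff => x xA.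
rewrite /distinct (values_ratr f'P) undup_map_inj ?size_map ?ratr_nat //.
exact: fmorph_inj.
Qed.

(** * Finite sums and products, and functions of the cell *)

Lemma definable_bigsum (I : Type) (s : seq I)
    (F : I -> cube Dim k l -> cell Dim -> rat) :
  (forall i, definable (F i)) -> definable (fun D x => \sum_(i <- s) F i D x).
Proof.
move=> dF; elim: s => [|i s IH].
  by apply: eq_definable (definable_const 0) => D x _; rewrite big_nil.
by apply: eq_definable (definable_add (dF i) IH) => D x _; rewrite big_cons.
Qed.

Lemma definable_bigprod (I : Type) (s : seq I)
    (F : I -> cube Dim k l -> cell Dim -> rat) :
  (forall i, definable (F i)) -> definable (fun D x => \prod_(i <- s) F i D x).
Proof.
move=> dF; elim: s => [|i s IH].
  by apply: eq_definable (definable_const 1) => D x _; rewrite big_nil.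
by apply: eq_definable (definable_mul (dF i) IH) => D x _; rewrite big_cons.
Qed.

Lemma definable_cell (c : cell Dim) : definable (fun _ x => (x == c)%:R).
Proof.
have dc i : definable (fun _ x => (rho (x i) (c i))%:R).
  apply: (@definable_step0 (TLevelEq k (c i))) => D st v _.
  by apply: eq_in_iff => x xA; rewrite ratr_nat.
apply: eq_definable (definable_bigprod (index_enum 'I_d) dc) => D x _.
have [->|xc] := eqVneq x c; first by rewrite big1 // => i _; rewrite rho_bot eqxx.
(* A coordinate where [x] and [c] differ contributes a factor 0 to the product of selectors. *)
have [i xci] : exists i, x i != c i.
  apply/existsP; apply: contraNT xc => /existsPn xc; apply/eqP/ffunP => i.
  exact/eqP/negPn.
by rewrite (bigD1 i) //= rho_bot (negPf xci) mul0r.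
Qed.

(** The parameter [c] ranges over all cells of the matrix, a finite set known before the cube, so
    the sum has a fixed number of terms; only the term with [c = x] survives at [x]. *)
Lemma definable_pointwise (G : cell Dim -> cube Dim k l -> cell Dim -> rat) :
  (forall c, definable (G c)) -> definable (fun D x => G x D x).
Proof.
move=> dG; have := definable_bigsum (index_enum (cell Dim))
  (fun c => definable_mul (definable_cell c) (dG c)).
apply: eq_definable => D x _.
rewrite (bigD1 x) //= eqxx mul1r big1 ?addr0 // => c.
by rewrite eq_sym => /negPf->; rewrite mul0r.
Qed.

Lemma definable_static (s : cell Dim -> rat) : definable (fun _ => s).
Proof.
by apply: (@definable_pointwise (fun c _ _ => s c)) => c; apply: definable_const.
Qed.

(** * Boolean measures and case distinction *)

Definition definable_bool B : Prop := definable (fun D x => (B D x)%:R).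

Lemma definable_negb B : definable_bool B -> definable_bool (fun D x => ~~ B D x).
Proof.
move=> dB; apply: eq_definable (definable_eq dB (definable_const 0)) => D x _.
by case: (B D x).
Qed.

Lemma definable_andb B1 B2 : definable_bool B1 -> definable_bool B2 ->
  definable_bool (fun D x => B1 D x && B2 D x).
Proof.
move=> dB1 dB2; apply: eq_definable (definable_mul dB1 dB2) => D x _.
by rewrite -natrM mulnb.
Qed.

Lemma definable_if B F G : definable_bool B -> definable F -> definable G ->
  definable (fun D x => if B D x then F D x else G D x).
Proof.
move=> dB dF dG; apply: eq_definable (definable_add (definable_mul dB dF)
  (definable_mul (definable_negb dB) dG)) => D x _.
by case: (B D x); rewrite !(mul0r, mul1r, addr0, add0r).
Qed.

Lemma definable_bool_static (s : cell Dim -> bool) : definable_bool (fun _ => s).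
Proof. exact: definable_static. Qed.

(** * Aggregates over groups of cells *)

Lemma mem_values_if (A S : {set cell Dim}) (f : cell Dim -> rat) w v :
  v \in [seq (if y \in S then f y else w) | y in A] ->
  v \in [seq f y | y in A :&: S] \/ v = w.
Proof.
case/imageP => y yA ->; case: ifP => yS; last by right.
by left; apply/image_f; rewrite inE yA.
Qed.

Lemma values_if_mem (A S : {set cell Dim}) (f : cell Dim -> rat) w :
  {subset [seq f y | y in A :&: S] <= [seq (if y \in S then f y else w) | y in A]}.
Proof.
move=> _ /imageP[y yAS ->]; apply/imageP; have /setIP[yA yS] := yAS.
by exists y; rewrite ?yS.
Qed.

(* To aggregate over [S] only, [SUM] is applied to [F] times the indicator of
   [S], and [MIN], [MAX] and [COUNT-DISTINCT] to [F] changed outside [S] to a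
   value that does not affect the result: the global maximum, the global
   minimum, and the minimum over [S], respectively. *)
Lemma definable_agg (f : aggregate) (S : {set cell Dim}) F : definable F ->
  definable (fun D _ => agg f [seq F D y | y in live D :&: S]).
Proof.
move=> dF.
have dS : definable_bool (fun _ y => y \in S) by exact: definable_static.
have agg_sum G : definable G -> definable (fun D _ => \sum_(y in live D :&: S) G D y).
  move=> dG; apply: eq_definable (definable_sum (definable_mul dG dS)) => D x _.
  rewrite [RHS](eq_bigl _ _ (fun y => in_setI y _ _)) big_mkcondr /=.
  by apply: eq_bigr => y _; case: (y \in S); rewrite ?(mulr1, mulr0).
have size_values D : size [seq F D y | y in live D :&: S] = #|live D :&: S|.
  by rewrite size_map cardE.
have agg_count : definable (fun D _ => #|live D :&: S|%:R).
  apply: eq_definable (agg_sum _ (definable_const 1)) => D x _.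
  by rewrite big_const iter_addr_0 -mulr_natl mulr1.
have nonempty_S : definable_bool (fun D _ => live D :&: S != set0).
  apply: eq_definable (definable_negb
    (definable_eq agg_count (definable_const 0))) => D x _.
  by rewrite pnatr_eq0 cards_eq0.
(* Altering the values outside [S] is of no help when [S] has no non-empty cell. There the result
   must be the default 0, which is supplied by a case distinction. *)
have when_nonempty (g : seq rat -> rat) G : g [::] = 0 -> definable G ->
    (forall D x, live D :&: S != set0 ->
       G D x = g [seq F D y | y in live D :&: S]) ->
    definable (fun D _ => g [seq F D y | y in live D :&: S]).
  move=> g0 dG GP; apply: eq_definable
    (definable_if nonempty_S dG (definable_const 0)) => D x _.
  by case: eqVneq => [->|/GP->] //=; rewrite /image_mem enum_set0.
have values_neq0 D : live D :&: S != set0 ->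
    [seq F D y | y in live D :&: S] != [::].
  by rewrite -!size_eq0 size_values cards_eq0.
have agg_min : definable (fun D _ => seqmin [seq F D y | y in live D :&: S]).
  apply: (when_nonempty (@seqmin rat) _ _
    (definable_min (definable_if dS dF (definable_max dF)))).
    by rewrite /seqmin big_nil.
  move=> D _ /values_neq0 /seqmin_mem m_in.
  apply: seqmin_eq; first exact: values_if_mem.
  move=> v /mem_values_if[/seqmin_le//|->].
  by apply: seqmax_ge; case/imageP: m_in => y /setIP[yA _] ->; apply: image_f.
case: f => /=.
- apply: eq_definable (agg_sum _ dF) => D x _.
  by rewrite big_map big_enum.
- apply: eq_definable (definable_div (agg_sum _ dF) agg_count) => D x _.
  (* For an empty group the convention [a/0 := a] returns the empty sum 0, which agrees with
     [agg Avg]. *)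
  rewrite size_values big_map big_enum /= pnatr_eq0 cards_eq0.
  by case: eqP => // ->; rewrite big_set0 mul0r.
- exact: agg_min.
- apply: (when_nonempty (@seqmax rat) _ _
    (definable_max (definable_if dS dF (definable_min dF)))).
    by rewrite /seqmax big_nil.
  move=> D _ /values_neq0 /seqmax_mem m_in.
  apply: seqmax_eq; first exact: values_if_mem.
  move=> v /mem_values_if[/seqmax_ge//|->].
  by apply: seqmin_le; case/imageP: m_in => y /setIP[yA _] ->; apply: image_f.
- by apply: eq_definable agg_count => D x _; rewrite size_values.
- apply: (when_nonempty (fun s => (size (undup s))%:R) _ _
    (definable_distinct (definable_if dS dF agg_min))) => //.
  move=> D _ /values_neq0 /seqmin_mem m_in.
  congr _%:R; apply: eq_size_undup => v; apply/idP/idP; last exact: values_if_mem.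
  by case/mem_values_if => // ->.
Qed.

(** For a fixed [c] the cells related to [c] form a set independent of the cube, to which
    [definable_agg] applies; [definable_pointwise] then puts the current cell in place of [c]. *)
Lemma definable_group_agg (f : aggregate) (E : rel (cell Dim)) F : definable F ->
  definable (fun D x => agg f [seq F D y | y in [set y in live D | E x y]]).
Proof.
move=> dF; apply: eq_definable (definable_pointwise (fun c =>
  definable_agg f [set y | E c y] dF)) => D x _; congr (agg f).
by apply: eq_image => // y; rewrite !inE.
Qed.

(** * Dice conditions and families of measures *)

Lemma definable_measure (a : 'I_k + 'I_l) :
  definable (fun D x => if D x is Some c then measure_of a c else 0).
Proof. by case: a => j; [exact: definable_mu | exact: definable_tau]. Qed.

Lemma definable_holds (p : cond Dim k l) :
  definable_bool (fun D x => if D x is Some c then holds p x c else false).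
Proof.
elim: p => [i lv b|i lv b|i lv b|a c|a c|a c|p IH|p IHp q IHq|p IHp q IHq].
- apply: eq_definable (definable_bool_static (fun x => rho (x i) b)) => D x.
  by rewrite inE; case: (D x).
- apply: eq_definable (definable_bool_static (fun x =>
    [exists b' : dom lv, rho (x i) b' && level_lt b' b])) => D x.
  by rewrite inE; case: (D x).
- apply: eq_definable (definable_bool_static (fun x =>
    [exists b' : dom lv, rho (x i) b' && level_lt b b'])) => D x.
  by rewrite inE; case: (D x).
- apply: eq_definable (definable_eq (definable_measure a) (definable_const c)) => D x.
  by rewrite inE; case: (D x).
- apply: eq_definable (definable_lt (definable_measure a) (definable_const c)) => D x.
  by rewrite inE; case: (D x).
- apply: eq_definable (definable_lt (definable_const c) (definable_measure a)) => D x.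
  by rewrite inE; case: (D x).
- apply: eq_definable (definable_negb IH) => D x; rewrite inE; by case: (D x).
- apply: eq_definable (definable_andb IHp IHq) => D x; rewrite inE; by case: (D x).
(* Disjunction is reduced to negation and conjunction by De Morgan. *)
- apply: eq_definable (definable_negb (definable_andb (definable_negb IHp)
    (definable_negb IHq))) => D x; rewrite inE.
  by case: (D x) => //= c _; rewrite negb_and !negbK.
Qed.

(** A single sequence of transformations computes finitely many measures: the sequences are
    concatenated, and measures already computed survive the later steps. *)
Lemma definable_family (I : eqType) (s : seq I)
    (F : I -> cube Dim k l -> cell Dim -> rat) :
  (forall i, definable (F i)) ->
  exists ts (a : I -> mref k), forall D,
    (exists st', exec (init R D) ts st') /\
    (forall st', exec (init R D) ts st' ->
       {in s, forall i, represents st' (a i) (F i D)}).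
Proof.
move=> dF; elim: s => [|i s [ts [a IH]]].
  exists [::], (fun=> inr 0) => D; split=> //; by exists (init R D).
have [ts' [b bP]] := dF i (l + size ts)%N.
have szP D st' : exec (init R D) ts st' -> size (computed st') = (l + size ts)%N.
  by move/size_exec ->; rewrite /= size_map -cardE card_ord.
exists (ts ++ ts'), (fun j => if j == i then b else a j) => D.
have [[st1 e1] r1] := IH D; split=> [|st2 /exec_cat[st1' e1' e2']].
  have [[st2 e2] _] := bP D _ (extends_exec e1) (szP _ _ e1).
  by exists st2; apply/exec_cat; exists st1.
have [_ r2] := bP D _ (extends_exec e1') (szP _ _ e1').
move=> j; rewrite inE; case: eqP => [-> _|_ /= js]; first exact: r2.
exact/(represents_extends (extends_exec e2'))/r1.
Qed.

End Definable.

(** * From definable measures to OLAP operations *)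

Section Expressibility.
Local Open Scope ring_scope.
Variables (R : rcfType) (d : nat) (Dim : 'I_d -> dimension) (k : nat).

(* Moves measures to the end of the list, in a prescribed order, by adding a
   measure [z] that is constantly 0. *)
Lemma exec_copy (I : eqType) (st : state Dim R k) (z : mref k) (s : seq I)
    (a : I -> mref k) (F : I -> cell Dim -> rat) :
  represents st z (fun=> 0) -> {in s, forall i, represents st (a i) (F i)} ->
  let ts := [seq TAdd Dim (a i) z | i <- s] in
  (exists st', exec st ts st') /\
  (forall st', exec st ts st' -> forall i0 j, (j < size s)%N ->
     represents st' (inr (size (computed st) + j)%N) (F (nth i0 s j))).
Proof.
elim: s st => [|i s IH] st rz rs /=; first by split=> //; exists st.
have addP v : creates st (TAdd Dim (a i) z) v <->
    {in nonempty st, forall x, v x = ratr (F i x)}.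
  have := rs i (mem_head i s); move: rz; rewrite /represents /= /reading.
  case: (read st (a i)) => // f; case: (read st z) => // g gP fP.
  by apply: eq_in_iff => x xA; rewrite fP // gP // rmorph0 addr0.
have IHv v := IH (push_atomic st (TAdd Dim (a i) z) v)
  (represents_extends (extends_push _ _ _ _) rz)
  (fun j js => represents_extends (extends_push _ _ _ _)
     (rs j (mem_behead (s := i :: s) js))).
split=> [|st' [v cv est'] i0 [_|j]].
- have [[st' est'] _] := IHv (fun x => ratr (F i x)).
  by exists st'; exists (fun x => ratr (F i x)) => //; apply/addP.
- rewrite addn0; apply: represents_extends (extends_exec est') _.
  exact/represents_push/addP.
rewrite ltnS => js; have [_ /(_ _ est' i0 j js)] := IHv v.
by rewrite /= size_rcons addSnnS.
Qed.

(** Destructors and flags will be existing measures; representing a Boolean function guarantees that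
    their values are 0 or 1. *)
Lemma creates_existing (st : state Dim R k) (a : mref k) (F : cell Dim -> bool) v :
  represents st a (fun x => (F x)%:R) ->
  creates_bool st (inr a) v <-> {in nonempty st, forall x, v x = (F x)%:R}.
Proof.
rewrite /represents /creates_bool /reading; case: (read st a) => // f fP.
split=> [[_ vP] x xA|vP]; first by rewrite vP // fP // ratr_nat.
split=> x xA; last by rewrite vP // fP // ratr_nat.
by rewrite vP //; case: (F x); [right|left].
Qed.

Lemma represents_nth (st : state Dim R k) n F v0 : represents st (inr n) F ->
  {in nonempty st, forall x, (nth v0 (computed st) n).1 x = ratr (F x)}.
Proof.
rewrite /represents /reading /=; case E: (onth _ n) => [v|//] /= vP x xA.
by rewrite (onth_nth _ _ _ _ E) vP.
Qed.

(** Common criterion for all classical operations. Everything needed is computed first; then the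
    output measures are copied in order to the end of the list, since an operation outputs its last
    [m] measures. *)
Lemma expressible_definable (l m : nat) (F : 'I_m -> cube Dim k l -> cell Dim -> rat)
    (delta phi : cube Dim k l -> cell Dim -> bool) (C : cube Dim k l -> cube Dim k m) :
  (forall j, definable R (F j)) -> definable_bool R delta -> definable_bool R phi ->
  (forall D x, C D x = if D x is Some c then
     if delta D x then Some (Content (mu c) [ffun j => F j D x] (phi D x)) else None
   else None) ->
  expressible R C.
Proof.
move=> dF ddelta dphi CP.
(* The three options add the destructor, the flag and the constant 0 used for copying to the [m]
   output measures. *)
pose G (i : option (option (option 'I_m))) : cube Dim k l -> cell Dim -> rat :=
  match i with
  | None => fun D x => (delta D x)%:R
  | Some None => fun D x => (phi D x)%:R
  | Some (Some None) => fun _ _ => 0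
  | Some (Some (Some j)) => F j
  end.
have dG i : definable R (G i).
  by case: i => [[[j|]|]|] //=; exact: definable_const.
have [ts [a aP]] := definable_family (enum {: option (option (option 'I_m))}) dG.
pose copies :=
  [seq TAdd Dim (a (Some (Some (Some j)))) (a (Some (Some None))) | j <- enum 'I_m].
have szc : size copies = m by rewrite size_map size_enum_ord.
have arity : (m <= l + size (ts ++ copies))%N.
  by rewrite size_cat szc addnA leq_addl.
have run D : (exists st, exec (init R D) (ts ++ copies) st) /\
    forall st, exec (init R D) (ts ++ copies) st ->
    [/\ nonempty st = live D, represents st (a None) (G None D),
        represents st (a (Some None)) (G (Some None) D)
      & forall j : 'I_m, {in live D, forall x, out_measure st m j x = ratr (F j D x)}].
  have [[st1 e1] r1] := aP D.
  have copyP st1' : exec (init R D) ts st1' -> _ := fun e1' =>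
    exec_copy (s := enum 'I_m) (F := fun j => F j D)
      (r1 _ e1' (Some (Some None)) (mem_enum _ _))
      (fun j _ => r1 _ e1' (Some (Some (Some j))) (mem_enum _ _)).
  split=> [|st /exec_cat[st1' e1' e2]].
    by have [[st e2] _] := copyP _ e1; exists st; apply/exec_cat; exists st1.
  have [nst _ _] := extends_trans (extends_exec e1') (extends_exec e2).
  split=> //;
    try exact: represents_extends (extends_exec e2) (r1 _ e1' _ (mem_enum _ _)).
  move=> j x xA; have [_ /(_ _ e2 j j)] := copyP _ e1'.
  rewrite size_enum_ord ltn_ord nth_ord_enum => /(_ isT)/(represents_nth (fun=> 0, None)).
  rewrite nst => /(_ _ xA) <-.
  (* Copying takes exactly [m] steps, so the last [m] positions start where copying began. *)
  by rewrite /out_measure (size_exec e2) -/copies szc addnK.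
exists (OlapOp (Some (inr (a None))) (inr (a (Some None))) arity) => D D'.
have [[st0 e0] runP] := run D.
(* Uniqueness: in non-empty cells every run has the prescribed destructor, flag and measures, and
   the latter determine rationals because [ratr] is injective. *)
split=> [[st [st' [dl [ph [e [dlP ->] phP out]]]]]|->].
  have [nst rd rp om] := runP _ e.
  have {}dlP := (creates_existing _ rd).1 dlP.
  have {}phP := (creates_existing _ (represents_extends (extends_push _ _ _ _) rp)).1 phP.
  apply/ffunP => x; rewrite CP; have := out x; case Dx: (D x) => [c|//].
  have xA : x \in live D by rewrite inE Dx.
  rewrite dlP ?nst //; case: (delta D x); last by rewrite eqxx.
  rewrite oner_eq0 => -[t tP ->]; congr (Some (Content _ _ _)).
    by apply/ffunP => j; rewrite ffunE; have := tP j; rewrite om // => /fmorph_inj.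
  by rewrite phP /= ?nst //; case: (phi D x); rewrite ?eqxx // eq_sym oner_eq0.
(* Existence: the run [st0] is completed by the 0/1 measures of [delta] and [phi]. *)
have [nst rd rp om] := runP _ e0.
exists st0, (push_source st0 (inr (a None)) (fun x => (delta D x)%:R)).
exists (fun x => (delta D x)%:R), (fun x => (phi D x)%:R); split=> //.
- by split=> //; apply/(creates_existing _ rd).
- exact/(creates_existing _ (represents_extends (extends_push _ _ _ _) rp)).
move=> x; rewrite CP; case Dx: (D x) => [c|//].
have xA : x \in live D by rewrite inE Dx.
case: (delta D x); last by rewrite eqxx.
rewrite oner_eq0; exists [ffun j => F j D x]; first by move=> j; rewrite ffunE om.
by case: (phi D x); rewrite ?eqxx // [0 == 1]eq_sym oner_eq0.
Qed.

(** * The classical operations *)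

Lemma expressible_dice l (p : cond Dim k l) : expressible R (dice_out p).
Proof.
refine (expressible_definable (@definable_tau R _ Dim k l)
  (definable_holds R p) (definable_bool_static R k l (fun=> true)) _); move=> D x.
rewrite ffunE; case: (D x) => [c|//]; case: ifP => // _.
by congr (Some (Content _ _ _)); apply/ffunP => j; rewrite ffunE.
Qed.

Lemma expressible_slice_dice l (i : 'I_d) (a : base (Dim i)) :
  expressible R (@slice_dice_out _ Dim k l i a).
Proof.
refine (expressible_definable (@definable_tau R _ Dim k l)
  (definable_bool_static R k l (fun x => x i == a))
  (definable_bool_static R k l (fun=> true)) _); move=> D x.
rewrite ffunE; case: (D x) => [c|//]; case: ifP => // _.
by congr (Some (Content _ _ _)); apply/ffunP => j; rewrite ffunE.
Qed.

Lemma upd_inj (x : cell Dim) (i : 'I_d) : injective (@upd _ Dim x i).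
Proof. by move=> y z /ffunP/(_ i); rewrite !ffunE !dfwith_in. Qed.

(** Passes from groups listed by their i-th coordinate to groups given as sets of cells, the form of
    [definable_group_agg]. Since [upd x] is injective, each cell is listed once and multiplicities
    agree. *)
Lemma perm_values_upd l (D : cube Dim k l) (a : 'I_k + 'I_l) (x : cell Dim) (i : 'I_d)
    (P : pred (base (Dim i))) :
  perm_eq
    (pmap (fun y => omap (measure_of a) (D (upd x y)))
       [seq y <- enum (base (Dim i)) | P y])
    [seq (if D z is Some c then measure_of a c else 0)
       | z in [set z in live D | [exists y, (z == upd x y) && P y]]].
Proof.
set g := fun z => if D z is Some c then measure_of a c else 0.
have -> s : pmap (fun y => omap (measure_of a) (D (upd x y))) s =
    [seq g z | z <- [seq upd x y | y <- s] & z \in live D].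
  elim: s => //= y s ->; rewrite inE /g; case Dy: (D (upd x y)) => [c|] //=.
  by rewrite Dy.
apply/perm_map/uniq_perm; rewrite ?enum_uniq //.
  by rewrite filter_uniq // (map_inj_uniq (@upd_inj x i)) filter_uniq ?enum_uniq.
move=> z; rewrite mem_filter mem_enum [RHS]inE; congr (_ && _).
apply/mapP/existsP => [[y]|[y /andP[/eqP-> Py]]].
  by rewrite mem_filter => /andP[Py _] ->; exists y; rewrite eqxx.
by exists y => //; rewrite mem_filter Py mem_enum.
Qed.

Lemma expressible_slice l (i : 'I_d) : expressible R (@slice_out _ Dim k l i).
Proof.
refine (expressible_definable
  (* The group is the whole line through [x] in dimension [i]; the conjunct [true] matches
     [perm_values_upd] with the constant predicate. *)
  (fun n => definable_group_agg Sum (fun x z => [exists y, (z == upd x y) && true])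
     (definable_measure R Dim (inl n : 'I_k + 'I_l)))
  (definable_bool_static R k l (fun x => is_rep \top%O (x i)))
  (definable_bool_static R k l (fun=> true)) _); move=> D x.
rewrite ffunE; case: (D x) => [c|//]; case: ifP => // _.
congr (Some (Content _ _ _)); apply/ffunP => n; rewrite !ffunE.
apply: etrans (perm_agg Sum (@perm_values_upd l D (inl n) x i (fun=> true))).
rewrite /= filter_predT.
(* Empty cells add 0 on one side and are dropped by [pmap] on the other. *)
rewrite -big_enum; elim: (enum _) => [|y s IH]; first by rewrite /= !big_nil.
by rewrite big_cons IH /=; case: (D (upd x y)) => [c'|] /=; rewrite ?big_cons ?add0r.
Qed.

Lemma expressible_roll_up l (i : 'I_d) (lv : level (Dim i)) (H : seq (level (Dim i)))
    (r : nat) (af : r.-tuple (('I_k + 'I_l) * aggregate)) :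
  expressible R (roll_up_out lv H af).
Proof.
refine (expressible_definable
  (fun j => definable_group_agg (tnth af j).2
     (fun x z => [exists y, (z == upd x y) &&
        [exists b : dom lv, rho_in H (x i) b && rho_in H y b]])
     (definable_measure R Dim (tnth af j).1))
  (definable_bool_static R k l (fun=> true))
  (definable_bool_static R k l (fun x => is_rep lv (x i))) _); move=> D x.
rewrite ffunE; case: (D x) => [c|//].
congr (Some (Content _ _ _)); apply/ffunP => j; rewrite !ffunE.
exact/perm_agg/perm_values_upd.
Qed.

Lemma expressible_classical l (C : classical Dim k l) : expressible R (classical_out C).
Proof.
case: C => [p|i|i a|i lv H _ r af|i lv' lv H _ _ _ r af] /=.
- exact: expressible_dice.
- exact: expressible_slice.
- exact: expressible_slice_dice.
- exact: expressible_roll_up.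
(* Drill-down is a roll-up to the lower level along the truncated hierarchy. *)
- exact: expressible_roll_up.
Qed.

(** One OLAP operation per classical operation. Each has exactly one possible output, so the
    intermediate cubes, and hence the final one, are forced. *)
Lemma expressible_classical_seq l n (Cs : classical_seq Dim k l n) :
  expressible_by_seq R (classical_seq_out Cs).
Proof.
elim: Cs => [m|m p C Cs [Os OsP]]; first by exists (ONil _ _ m).
have [O OP] := expressible_classical C; exists (OCons O Os) => D D''.
split=> [[D' /OP-> /OsP//]|->]; exists (classical_out C D); [exact/OP | exact/OsP].
Qed.

End Expressibility.

Theorem theorem1 (R : rcfType) (d : nat) (d_gt0 : 0 < d)
    (Dim : 'I_d -> dimension) (k : nat) :
  (forall (l : nat) (C : classical Dim k l), expressible R (classical_out C)) /\
  (forall (l n : nat) (Cs : classical_seq Dim k l n),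
     expressible_by_seq R (classical_seq_out Cs)).
Proof.
by split; [exact: expressible_classical | exact: expressible_classical_seq].
Qed.
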